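(* Let $l\ge 0$ be an integer, and for $R=R(\alpha,\beta,\gamma)\in SO(3)$ with $\alpha,\gamma\in[0,2\pi)$, $\beta\in[0,\pi]$, let $U^l(R)=\overline{T^l}\,D^l(R)\,(T^l)^T$ be the real harmonics on $SO(3)$ (with $T^l$ and $D^l$ as in the context). Define, for $m,n\in\{-l,\dots,l\}$, $$\Psi^l_{m,n}(\beta)=\begin{cases}(-1)^{m-n}d^l_{|m|,|n|}(\beta)+(-1)^m\,\mathrm{sgn}(m)\,d^l_{|m|,-|n|}(\beta) & mn\neq 0,\\ (-1)^{m-n}\sqrt2\, d^l_{|m|,|n|}(\beta) & \text{exactly one of } m,n \text{ is } 0,\\ d^l_{0,0}(\beta) & m=n=0,\end{cases}$$ which satisfies $\Psi^l_{m,n}=\Psi^l_{m,-n}$. Then for all $m,n\in\{-l,\dots,l\}$: (i) if ($m\ge0$ and $n\ge0$) or ($m<0$ and $n<0$), then $$U^l_{m,n}(R)=-\sin (m\alpha)\,\sin (n\gamma)\,\Psi^l_{-m,n}(\beta)+\cos (m\alpha)\,\cos (n\gamma)\,\Psi^l_{m,n}(\beta);$$ (ii) if ($m\ge0$ and $n<0$) or ($m<0$ and $n\ge0$), then $$U^l_{m,n}(R)=-\sin (m\alpha)\,\cos (n\gamma)\,\Psi^l_{-m,n}(\beta)+\cos (m\alpha)\,\sin (n\gamma)\,\Psi^l_{m,n}(\beta).$$ Equivalently, in matrix form, $$U^l(R)=X^l(\alpha)\,W^l(\beta)\,X^l(\gamma),$$ where $X^l(\alpha),W^l(\beta)\in\mathbb{R}^{(2l+1)\times(2l+1)}$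 are given by $$X^l_{m,n}(\alpha)=\begin{cases}0&|m|\ne|n|,\\1&m=n=0,\\ \cos (m\alpha)&m=n\neq0,\\ -\sin (m\alpha)&m=-n\ne0,\end{cases}\qquad W^l_{m,n}(\beta)=\begin{cases}\Psi^l_{m,n}(\beta)&(m\ge0,\ n\ge0)\text{ or }(m<0,\ n<0),\\0&\text{otherwise.}\end{cases}$$
   Context: All $(2l+1)\times(2l+1)$ matrices have rows and columns indexed by $m,n\in\{-l,\dots,l\}$ in ascending order. Euler angles: for $x\in\mathbb{R}^3$, $\hat x$ is the skew-symmetric $3\times3$ matrix with $\hat x y=x\times y$; $e_1,e_2,e_3$ is the standard basis of $\mathbb{R}^3$; $R(\alpha,\beta,\gamma)=\exp(\alpha\hat e_3)\exp(\beta\hat e_2)\exp(\gamma\hat e_3)$ (3-2-3 Euler angles). Every $R\in SO(3)$ has this form with $\alpha,\gamma\in[0,2\pi)$, $\beta\in[0,\pi]$. Wigner matrices: $D^l:SO(3)\to\mathbb{C}^{(2l+1)\times(2l+1)}$ is the irreducible unitary representation (a homomorphism) given by $D^l_{m,n}(R(\alpha,\beta,\gamma))=e^{-im\alpha}d^l_{m,n}(\beta)e^{-in\gamma}$, where $d^l(\beta)$ is the real Wigner d-matrix. With the paper's convention $d^l(\beta)=\exp(\beta A^l)$, where $A^l_{m,n}=-\tfrac12\sqrt{(l+m)(l-m+1)}\,\delta_{m-1,n}+\tfrac12\sqrt{(l-m)(l+m+1)}\,\delta_{m+1,n}$ (this is the standard Wigner d-matrix of quantum mechanics). The matrix $T^l\in\mathbb{C}^{(2l+1)\times(2l+1)}$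 is $$T^l_{m,n}=\begin{cases}1&m=n=0,\\0&|m|\ne|n|,\\ (-1)^m/\sqrt2&m>0,\ n=m,\\ 1/\sqrt2&m>0,\ n=-m,\\ i/\sqrt2&m<0,\ n=m,\\ -i(-1)^m/\sqrt2&m<0,\ n=-m.\end{cases}$$ It is unitary. $\overline{T^l}$ denotes the entrywise complex conjugate, and $\mathrm{sgn}(m)=\pm1$ according to the sign of $m\neq0$. *)

(* Defs.v *)
From mathcomp Require Import all_boot all_order all_algebra.
From mathcomp Require Import complex.
From mathcomp Require Import all_classical all_reals all_analysis.

Set Implicit Arguments.
Unset Strict Implicit.
Unset Printing Implicit Defensive.

Import Order.TTheory GRing.Theory Num.Theory.
Import numFieldNormedType.Exports.

Local Open Scope classical_set_scope.
Local Open Scope ring_scope.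
Local Open Scope complex_scope.

Section ZIndex.
Variables (K : Type) (l : nat).

(* Rows and columns are indexed by the integers -l, ..., l in ascending order:
   the ordinal i stands for the integer i - l. *)
Definition zmx (f : int -> int -> K) : 'M[K]_((2 * l).+1) :=
  \matrix_(i, j) f (i%:Z - l%:Z) (j%:Z - l%:Z).

(* Only meaningful for -l <= m <= l and -l <= n <= l (see [zentry_zmx]). *)
Definition zentry (M : 'M[K]_((2 * l).+1)) (m n : int) : K :=
  M (inord (absz (m + l%:Z))) (inord (absz (n + l%:Z))).

Lemma zentry_zmx f m n :
  - l%:Z <= m <= l%:Z -> - l%:Z <= n <= l%:Z -> zentry (zmx f) m n = f m n.
Proof.
have idx k : - l%:Z <= k <= l%:Z ->
    ((inord (absz (k + l%:Z)) : 'I_((2 * l).+1))%:Z - l%:Z)%R = k.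
  move=> /andP[lk kl].
  have k0 : 0 <= k + l%:Z by rewrite -lerBlDr sub0r.
  have kE : (absz (k + l%:Z))%:Z = k + l%:Z by rewrite gez0_abs.
  rewrite inordK ?kE ?addrK// ltnS -lez_nat kE mul2n -addnn PoszD.
  by rewrite lerD2r.
by move=> hm hn; rewrite /zentry mxE !idx.
Qed.

End ZIndex.

Section Wigner.
Variable R : realType.

Definition expmx n (A : 'M[R]_n.+1) : 'M[R]_n.+1 :=
  limn (series (fun k : nat => (k`!%:R)^-1 *: A ^+ k)).

(* The indices k + 1, k + 2 are taken modulo 3. *)
Definition crossmx (x y : 'cV[R]_3) : 'cV[R]_3 :=
  \col_k (x (k + 1) 0 * y (k + 2) 0 - x (k + 2) 0 * y (k + 1) 0).

Definition hat (x : 'cV[R]_3) : 'M[R]_3 :=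
  \matrix_(i, j) crossmx x (delta_mx j 0) i 0.

Lemma hat_mulmx (x y : 'cV[R]_3) : hat x *m y = crossmx x y.
Proof.
apply/colP => i; rewrite !mxE.
under eq_bigr do rewrite !mxE !eqxx !andbT mulrBl -!mulrA.
rewrite big_split /= sumrN -!mulr_sumr.
have sel (k : 'I_3) : \sum_j (k == j)%:R * y j 0 = y k 0.
  rewrite (bigD1 k)//= eqxx mul1r big1 ?addr0// => j jk.
  by rewrite eq_sym (negbTE jk) mul0r.
by rewrite !sel.
Qed.

(* Coordinates of R^3 are numbered from 0. *)
Definition e2 : 'cV[R]_3 := delta_mx 1 0.
Definition e3 : 'cV[R]_3 := delta_mx 2 0.

Definition euler (a b c : R) : 'M[R]_3 :=
  expmx (a *: hat e3) *m expmx (b *: hat e2) *m expmx (c *: hat e3).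

Definition euler_range (a b c : R) : Prop :=
  [/\ 0 <= a < 2 * pi, 0 <= b <= pi & 0 <= c < 2 * pi].

Definition expi (x : R) : R[i] := cos x +i* sin x.

Section Degree.
Variable l : nat.

(* The matrix of -i J_y in the standard basis of J_z-eigenvectors, so that
   exp (b A) is the Wigner d-matrix of quantum mechanics. *)
Definition wignerA : 'M[R]_((2 * l).+1) :=
  zmx l (fun m n =>
    - (2^-1 * Num.sqrt ((l%:Z + m) * (l%:Z - m + 1))%:~R * (m - 1 == n)%:R)
    + 2^-1 * Num.sqrt ((l%:Z - m) * (l%:Z + m + 1))%:~R * (m + 1 == n)%:R).

Definition wignerd (b : R) : 'M[R]_((2 * l).+1) := expmx (b *: wignerA).

Definition wignerD_euler (a b c : R) : 'M[R[i]]_((2 * l).+1) :=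
  zmx l (fun m n =>
    expi (- (m%:~R * a)) * (zentry (wignerd b) m n)%:C * expi (- (n%:~R * c))).

(* D^l as a function of the rotation matrix Q itself: the Euler formula is
   applied to some triple of Euler angles of Q.  Such a triple exists for every
   Q in SO(3), and the value does not depend on the one that is picked.  Outside
   SO(3), where there is no such triple, the value is irrelevant. *)
Definition wignerD (Q : 'M[R]_3) : 'M[R[i]]_((2 * l).+1) :=
  let t := xget (0, 0, 0)
    [set t : R * R * R | euler_range t.1.1 t.1.2 t.2
                         /\ euler t.1.1 t.1.2 t.2 = Q] in
  wignerD_euler t.1.1 t.1.2 t.2.

(* The change of basis from complex to real harmonics. *)
Definition Tmx : 'M[R[i]]_((2 * l).+1) :=
  zmx l (fun m n =>
    let s : R[i] := (Num.sqrt 2)%:C in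
    if (m == 0) && (n == 0) then 1
    else if `|m| != `|n| then 0
    else if 0 < m then (if n == m then (-1) ^ m / s else 1 / s)
    else (if n == m then 'i / s else - 'i * (-1) ^ m / s)).

Definition realU (Q : 'M[R]_3) : 'M[R[i]]_((2 * l).+1) :=
  map_mx conjc Tmx *m wignerD Q *m Tmx^T.

Definition Psi (b : R) (m n : int) : R :=
  let d := zentry (wignerd b) in
  if m * n != 0 then
    (-1) ^ (m - n) * d `|m| `|n| + (-1) ^ m * (Num.sg m)%:~R * d `|m| (- `|n|)
  else if (m != 0) || (n != 0) then
    (-1) ^ (m - n) * Num.sqrt 2 * d `|m| `|n|
  else d 0 0.

Definition same_sign (m n : int) : bool :=
  (0 <= m) && (0 <= n) || (m < 0) && (n < 0).

Definition Xmx (a : R) : 'M[R]_((2 * l).+1) :=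
  zmx l (fun m n =>
    if `|m| != `|n| then 0
    else if (m == 0) && (n == 0) then 1
    else if m == n then cos (m%:~R * a)
    else - sin (m%:~R * a)).

Definition Wmx (b : R) : 'M[R]_((2 * l).+1) :=
  zmx l (fun m n => if same_sign m n then Psi b m n else 0).

End Degree.
End Wigner.

(* Main.v *)
Require Import Defs.
From mathcomp Require Import all_boot all_order all_algebra.
From mathcomp Require Import complex.
From mathcomp Require Import all_classical all_reals all_analysis.
From mathcomp Require Import ring lra zify.

Set Implicit Arguments.
Unset Strict Implicit.
Unset Printing Implicit Defensive.

Import Order.TTheory GRing.Theory Num.Theory.
Import numFieldNormedType.Exports.

Local Open Scope ring_scope.
Local Open Scope complex_scope.

(** The whole statement rests on one symmetry of the d-matrix,
    d_{-m,-n} = (-1)^(m-n) d_{m,n} ([wignerd_opp]).  Since row m of T only involves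
    the indices m and -m, an entry of U = conj(T) D T^T has at most four terms; the
    symmetry pairs them into complex conjugate phases, whose sums are the cosines
    and sines of m a + n c and of m a - n c.  The addition formulas turn this into
    the closed forms (i) and (ii) ([zentry_realU]).  The product X W X has the same
    support structure and gives the same closed forms ([zentry_XWX]); the symmetry
    of Psi in n is immediate from its definition ([Psi_oppr]).

    Since D is a function of the rotation matrix, evaluated through some choice of
    Euler angles, it must also be shown not to depend on that choice
    ([wignerD_eulerE]).  Angles in the given ranges are unique unless b is 0 or pi,
    when only a + c, resp. a - c, is determined ([euler_eq]).  For b = 0 the matrix
    d(b) is the identity; for b = pi it is supported on the antidiagonal
    ([wignerd_pi_eq0]).  In both cases the phases only depend on the combination
    that is determined.

    All identities between exponentials come from a uniqueness principle for M' = A M with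
    A skew-symmetric, namely conservation of the Frobenius norm ([skew_ode_unique]).
    It gives Rodrigues' formula for the two elementary rotations
    ([expmx_rodrigues]), the passage of the symmetry from the generator A of the
    d-matrix to its exponential ([expmx_skew_comm]), and, from the commutation
    relations [A, Jz] = Jx and [A, Jx] = - Jz, the identity
    d(b) Jz = (cos b Jz + sin b Jx) d(b) ([expmx_rotate]), which at b = pi says
    that d(pi) reverses the weights. *)

(** * Derivative of the matrix exponential *)
Section Exponential.
Variable R : realType.

(** Entries of exp (t A) are exponential generating functions in t of the entries
    of the powers of A, and those grow at most geometrically: comparison with the
    series of the real exponential. *)
Lemma is_cvg_pseries_egf (a : nat -> R) (C D : R) (x : R) :
  (forall k, `|a k| <= C * D ^+ k) ->
  cvgn (pseries (fun k => k`!%:R^-1 * a k) x).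
Proof.
move=> aCD; apply: normed_cvg.
apply: (@series_le_cvg _ _ (fun k => C * exp_coeff (`|D| * `|x|) k)).
- by move=> k; exact: normr_ge0.
- move=> k; rewrite mulr_ge0 //; last by rewrite exp_coeff_ge0// mulr_ge0.
  by have := aCD 0%N; rewrite expr0 mulr1; apply: le_trans.
- move=> k /=; rewrite !normrM normrX ger0_norm ?invr_ge0//.
  rewrite exp_coeffE [X in _ <= X]mulrCA -mulrA.
  rewrite ler_pM2l ?invr_gt0 ?ltr0n ?fact_gt0//.
  rewrite exprMn mulrA ler_wpM2r ?exprn_ge0//.
  apply: le_trans (aCD k) _; rewrite -normrX ler_wpM2l ?ler_norm//.
  by have := aCD 0%N; rewrite expr0 mulr1; apply: le_trans.
- have := @is_cvg_series_exp_coeff R (`|D| * `|x|).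
  by move=> /(is_cvg_seriesZ (k := C)).
Qed.

(** Formal differentiation of an exponential generating function is a shift of
    its coefficients. *)
Lemma pseries_diffs_egf (a : nat -> R) :
  pseries_diffs (fun k => k`!%:R^-1 * a k) = (fun k => k`!%:R^-1 * a k.+1).
Proof.
apply/funext => k; rewrite /pseries_diffs factS natrM invfM mulrA mulrA.
by rewrite mulfV ?mul1r// pnatr_eq0.
Qed.

Lemma is_derive_egf (a : nat -> R) (C D : R) (x : R) :
  (forall k, `|a k| <= C * D ^+ k) ->
  is_derive x 1 (fun x => limn (pseries (fun k => k`!%:R^-1 * a k) x))
                (limn (pseries (fun k => k`!%:R^-1 * a k.+1) x)).
Proof.
move=> aCD.
have aS p k : `|a (p + k)%N| <= C * D ^+ p * D ^+ k.
  by rewrite -mulrA -exprD.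
rewrite -pseries_diffs_egf; apply: (@pseries_snd_diffs _ _ (`|x| + 1)).
- exact: is_cvg_pseries_egf aCD.
- by rewrite pseries_diffs_egf; exact: is_cvg_pseries_egf (aS 1%N).
- by rewrite !pseries_diffs_egf; exact: is_cvg_pseries_egf (aS 2%N).
- by rewrite [ltRHS]ger0_norm ?addr_ge0// ltrDl.
Qed.

(** The exponential of a matrix is a limit for the uniform structure on matrices;
    having finitely many entries, it can be computed entry by entry. *)
Lemma cvg_mx_entries m n (u : nat -> 'M[R]_(m, n)) (L : 'M[R]_(m, n)) :
  (forall i j, (fun k => u k i j) @ \oo --> L i j)%classic ->
  (u @ \oo --> L)%classic.
Proof.
move=> uL; apply/cvg_mx_entourageP => A entA.
apply: filter_forall => i; apply: filter_forall => j.
have /cvg_app_entourageP /(_ A entA) := uL i j.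
by apply: filterS => k Aij; apply/mem_set.
Qed.

Section Entries.
Variables (n : nat) (A : 'M[R]_n.+1).

(** The sum of all absolute values of entries dominates every row sum, hence is
    a submultiplicative bound. *)
Lemma mxpow_entry_le i j k :
  `|(A ^+ k) i j| <= 1 * (\sum_p \sum_q `|A p q|) ^+ k.
Proof.
rewrite mul1r; elim: k i j => [|k IH] i j.
  by rewrite !expr0 mxE; case: eqP; rewrite ?normr1 ?normr0.
rewrite !exprS -mulmxE mxE; apply: le_trans (ler_norm_sum _ _ _) _.
rewrite [X in _ <= X * _](bigD1 i)//= mulrDl -[leLHS]addr0; apply: lerD.
  by rewrite mulr_suml; apply: ler_sum => q _; rewrite normrM ler_wpM2l.
by rewrite mulr_ge0 ?exprn_ge0// ?addr_ge0 ?sumr_ge0// => *; rewrite sumr_ge0.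
Qed.

Lemma expmxE (t : R) i j :
  expmx (t *: A) i j = limn (pseries (fun k => k`!%:R^-1 * (A ^+ k) i j) t).
Proof.
have cv p q := @is_cvg_pseries_egf _ _ _ t (mxpow_entry_le p q).
pose L := \matrix_(p, q) limn (pseries (fun k => k`!%:R^-1 * (A ^+ k) p q) t).
have -> : expmx (t *: A) = L; last by rewrite mxE.
apply: cvg_lim => //; apply: cvg_mx_entries => p q.
rewrite mxE; under eq_fun => k.
  rewrite /series /= summxE; under eq_bigr do
    rewrite exprZn scalerA mxE mulrAC.
  over.
exact: cv.
Qed.

Lemma is_derive_expmx (t : R) i j :
  is_derive t 1 (fun s => expmx (s *: A) i j) ((A *m expmx (t *: A)) i j).
Proof.
have -> : (fun s => expmx (s *: A) i j) =
    (fun s => limn (pseries (fun k => k`!%:R^-1 * (A ^+ k) i j) s)).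
  by apply/funext => s; rewrite expmxE.
have := is_derive_egf t (mxpow_entry_le i j).
suff -> : limn (pseries (fun k => k`!%:R^-1 * (A ^+ k.+1) i j) t) =
  (A *m expmx (t *: A)) i j by [].
have -> : pseries (fun k => k`!%:R^-1 * (A ^+ k.+1) i j) t =
    (fun N => \sum_p A i p * pseries (fun k => k`!%:R^-1 * (A ^+ k) p j) t N).
  apply/funext => N; rewrite /pseries /series /=.
  under [RHS]eq_bigr do rewrite mulr_sumr.
  rewrite exchange_big /=; apply: eq_bigr => k _.
  rewrite exprS -mulmxE mxE mulr_sumr mulr_suml; apply: eq_bigr => p _.
  ring.
apply: cvg_lim => //; rewrite mxE.
apply: (@cvg_big _ _ +%R 0) => [|p _]; first exact: add_continuous.
apply: cvgMl_tmp; rewrite expmxE.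
exact: is_cvg_pseries_egf (mxpow_entry_le p j).
Qed.

End Entries.

Lemma expmx0 n : expmx (0 : 'M[R]_n.+1) = 1%:M.
Proof.
apply: cvg_lim => //; apply: cvg_near_cst; exists 1%N => // -[//|N] _.
rewrite /series /= big_nat_recl// expr0 invr1 scale1r big1 ?addr0//.
by move=> k _; rewrite exprS mul0r scaler0.
Qed.

(** Differentiability is asked entrywise, so that the calculus rules below reduce
    to those for real functions. *)
Definition mxderiv m n (M : R -> 'M[R]_(m, n)) (t : R) (dM : 'M[R]_(m, n)) :=
  forall i j, is_derive t 1 (fun s => M s i j) (dM i j).

Lemma mxderiv_cst m n (B : 'M[R]_(m, n)) t : mxderiv (fun=> B) t 0.
Proof. by move=> i j; rewrite mxE; exact: is_derive_cst. Qed.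

Lemma mxderivZ m n (f : R -> R) (df : R) (B : 'M[R]_(m, n)) (t : R) :
  is_derive t 1 f df -> mxderiv (fun s => f s *: B) t (df *: B).
Proof.
move=> dft i j; rewrite mxE.
have -> : (fun s => (f s *: B) i j) = (B i j) \*: f.
  by apply/funext => s; rewrite mxE mulrC.
by rewrite mulrC; exact: is_deriveZ.
Qed.

Lemma mxderivD m n (M N : R -> 'M[R]_(m, n)) t dM dN :
  mxderiv M t dM -> mxderiv N t dN ->
  mxderiv (fun s => M s + N s) t (dM + dN).
Proof.
move=> dMt dNt i j; rewrite mxE.
have -> : (fun s => (M s + N s) i j) = (fun s => M s i j) + (fun s => N s i j).
  by apply/funext => s; rewrite mxE.
exact: is_deriveD.
Qed.

Lemma mxderivN m n (M : R -> 'M[R]_(m, n)) t dM :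
  mxderiv M t dM -> mxderiv (fun s => - M s) t (- dM).
Proof.
move=> dMt i j; rewrite mxE.
have -> : (fun s => (- M s) i j) = - (fun s => M s i j).
  by apply/funext => s; rewrite mxE.
exact: is_deriveN.
Qed.

Lemma mxderivM m n p (M : R -> 'M[R]_(m, n)) (N : R -> 'M[R]_(n, p)) t dM dN :
  mxderiv M t dM -> mxderiv N t dN ->
  mxderiv (fun s => M s *m N s) t (dM *m N t + M t *m dN).
Proof.
move=> dMt dNt i j.
have -> : (fun s => (M s *m N s) i j) =
    \sum_k (fun s => M s i k) * (fun s => N s k j).
  by apply/funext => s; rewrite mxE fct_sumE.
have -> : (dM *m N t + M t *m dN) i j =
    \sum_k (M t i k *: dN k j + N t k j *: dM i k).
  rewrite !mxE big_split /= addrC; congr (_ + _).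
  by apply: eq_bigr => k _; rewrite mulrC.
by apply: is_derive_sum => k; exact: is_deriveM.
Qed.

Lemma mxderiv_expmx n (A : 'M[R]_n.+1) t :
  mxderiv (fun s => expmx (s *: A)) t (A *m expmx (t *: A)).
Proof. by move=> i j; exact: is_derive_expmx. Qed.

(** The squared Frobenius norm of a solution M has derivative 2 tr(M^T A M), which
    vanishes because M^T A M is skew-symmetric along with A; the norm therefore
    keeps its initial value 0. *)
Lemma skew_ode_unique m n (A : 'M[R]_m) (M : R -> 'M[R]_(m, n)) (t : R) :
  A^T = - A -> M 0 = 0 ->
  (forall s, mxderiv M s (A *m M s)) ->
  M t = 0.
Proof.
move=> skA M0 dM.
pose f (s : R) : R := \sum_i \sum_j M s i j ^+ 2.
have df (s : R) : is_derive s 1 f 0.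
  have fE : f = \sum_i \sum_j (fun x => M x i j) ^+ 2.
    apply/funext => x; rewrite /f fct_sumE; apply: eq_bigr => i _.
    by rewrite fct_sumE; apply: eq_bigr => j _.
  have tr0 : \tr ((M s)^T *m (A *m M s)) = 0.
    suff xx0 : \tr ((M s)^T *m (A *m M s)) + \tr ((M s)^T *m (A *m M s)) = 0.
      by lra.
    rewrite -{1}mxtrace_tr !trmx_mul.
    by rewrite trmxK skA mulmxA -mxtraceD mulmxN mulNmx addNr mxtrace0.
  have dfs : is_derive s 1 f
      (\sum_i \sum_j (2%:R * M s i j ^+ 1) *: (A *m M s) i j).
    rewrite fE; apply: is_derive_sum => i; apply: is_derive_sum => j.
    by apply: is_deriveX; exact: dM.
  apply: is_derive_eq dfs _; rewrite exchange_big /=.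
  transitivity (2%:R * \tr ((M s)^T *m (A *m M s))); last by rewrite tr0 mulr0.
  rewrite /mxtrace mulr_sumr; apply: eq_bigr => j _.
  rewrite [in RHS]mxE mulr_sumr; apply: eq_bigr => i _.
  by rewrite expr1 [X in _ = _ * (X * _)]mxE mulrA.
have ft : f t = 0.
  rewrite (@is_derive_0_is_cst _ f t 0 df) /f M0.
  by rewrite big1// => i _; rewrite big1// => j _; rewrite mxE expr0n.
apply/matrixP => i j; rewrite mxE; apply/eqP; rewrite -sqrf_eq0; apply/eqP.
have := ft; rewrite /f => /eqP.
rewrite psumr_eq0 => [/allP /(_ i (mem_index_enum _)) /=|? _]; last first.
  by rewrite sumr_ge0// => ? _; rewrite sqr_ge0.
rewrite psumr_eq0 => [/allP /(_ j (mem_index_enum _)) /= /eqP //|? _].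
by rewrite sqr_ge0.
Qed.

(** Every identity below between matrix functions of an angle is obtained this
    way: both sides solve the same linear equation with a skew-symmetric
    generator and agree at 0. *)
Lemma skew_ode_eq m n (A : 'M[R]_m) (M N : R -> 'M[R]_(m, n)) (t : R) :
  A^T = - A -> M 0 = N 0 ->
  (forall s, mxderiv M s (A *m M s)) -> (forall s, mxderiv N s (A *m N s)) ->
  M t = N t.
Proof.
move=> skA MN0 dM dN; apply/eqP; rewrite -subr_eq0; apply/eqP.
apply: (@skew_ode_unique _ _ A (fun s => M s - N s)) => // [|s].
  by rewrite MN0 subrr.
by rewrite mulmxBr; apply: mxderivD => //; exact: mxderivN.
Qed.

(** * Exponentials of skew-symmetric matrices *)
Section SkewExponential.
Variables (n : nat) (A : 'M[R]_n.+1).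
Hypothesis skA : A^T = - A.

Lemma expmx_skew_comm (B : 'M[R]_n.+1) t :
  A *m B = B *m A -> expmx (t *: A) *m B = B *m expmx (t *: A).
Proof.
move=> AB.
apply: (@skew_ode_eq _ _ A (fun s => expmx (s *: A) *m B)
   (fun s => B *m expmx (s *: A)) t skA) => [|s|s].
- by rewrite scale0r expmx0 mul1mx mulmx1.
- have := mxderivM (mxderiv_expmx A s) (mxderiv_cst B s).
  by rewrite mulmx0 addr0 mulmxA.
- have := mxderivM (mxderiv_cst B s) (mxderiv_expmx A s).
  by rewrite mul0mx add0r !mulmxA AB.
Qed.

(** Rodrigues' formula: A^3 = - A holds for the hat matrix of a unit vector, and
    makes the right-hand side a solution of M' = A M. *)
Lemma expmx_rodrigues t :
  A *m (A *m A) = - A ->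
  expmx (t *: A) = 1%:M + (sin t *: A + (1 - cos t) *: (A *m A)).
Proof.
move=> A3.
apply: (@skew_ode_eq _ _ A (fun s => expmx (s *: A))
  (fun s => 1%:M + (sin s *: A + (1 - cos s) *: (A *m A))) t skA).
- by rewrite scale0r expmx0 sin0 cos0 subrr !scale0r !addr0.
- exact: mxderiv_expmx.
move=> s.
have dcos : is_derive s 1 (fun s : R => 1 - cos s) (sin s).
  have -> : (fun s : R => 1 - cos s) = cst 1 - cos by apply/funext.
  have := is_deriveB (is_derive_cst (1 : R) s 1) (is_derive_cos s).
  by rewrite sub0r opprK.
have := mxderivD (mxderiv_cst 1%:M s)
  (mxderivD (mxderivZ A (is_derive_sin s)) (mxderivZ (A *m A) dcos)).
suff -> : A *m (1%:M + (sin s *: A + (1 - cos s) *: (A *m A))) =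
  0 + (cos s *: A + sin s *: (A *m A)) by [].
rewrite !mulmxDr mulmx1 -!scalemxAr A3 scalerN scalerBl scale1r add0r.
by rewrite opprB addrCA [A + _]addrC addrNK addrC.
Qed.

(** Conjugation by exp (t A) rotates the plane spanned by Z and X when ad A does
    so infinitesimally. *)
Lemma expmx_rotate (Z X : 'M[R]_n.+1) t :
  A *m Z - Z *m A = X -> A *m X - X *m A = - Z ->
  expmx (t *: A) *m Z = (cos t *: Z + sin t *: X) *m expmx (t *: A).
Proof.
move=> AZ AX.
apply: (@skew_ode_eq _ _ A (fun s => expmx (s *: A) *m Z)
   (fun s => (cos s *: Z + sin s *: X) *m expmx (s *: A)) t skA) => [|s|s].
- by rewrite scale0r expmx0 cos0 sin0 scale1r scale0r addr0 mul1mx mulmx1.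
- have := mxderivM (mxderiv_expmx A s) (mxderiv_cst Z s).
  by rewrite mulmx0 addr0 mulmxA.
- have := mxderivM (mxderivD (mxderivZ Z (is_derive_cos s))
    (mxderivZ X (is_derive_sin s))) (mxderiv_expmx A s).
  set D := _ + _.
  suff -> : A *m ((cos s *: Z + sin s *: X) *m expmx (s *: A)) = D by [].
  rewrite /D !mulmxA -mulmxDl; congr (_ *m _).
  rewrite mulmxDr mulmxDl -!scalemxAr -!scalemxAl.
  rewrite -[A *m Z](subrK (Z *m A)) AZ -[A *m X](subrK (X *m A)) AX.
  rewrite !scalerDr scalerN scaleNr.
  by rewrite addrACA [_ + cos s *: X]addrC.
Qed.

End SkewExponential.

End Exponential.
(** * Entries of a rotation and uniqueness of its Euler angles *)
Section EulerAngles.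
Variable R : realType.

Definition mx33 (a b c d e f g h k : R) : 'M[R]_3 :=
  let rows := [:: [:: a; b; c]; [:: d; e; f]; [:: g; h; k]] in
  \matrix_(i, j) nth 0 (nth [::] rows i) j.

Ltac mx33_entries :=
  apply/matrixP => -[[|[|[|//]]] ?] [[|[|[|//]]] ?];
  rewrite !mxE ?big_ord_recl ?big_ord0 ?mxE /= ?mxE /=.

Lemma mul_mx33 a b c d e f g h k a' b' c' d' e' f' g' h' k' :
  mx33 a b c d e f g h k *m mx33 a' b' c' d' e' f' g' h' k' =
  mx33
    (a * a' + b * d' + c * g') (a * b' + b * e' + c * h')
    (a * c' + b * f' + c * k')
    (d * a' + e * d' + f * g') (d * b' + e * e' + f * h')
    (d * c' + e * f' + f * k')
    (g * a' + h * d' + k * g') (g * b' + h * e' + k * h')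
    (g * c' + h * f' + k * k').
Proof. by mx33_entries; rewrite addr0 addrA. Qed.

Lemma hat_e3 : hat (e3 R) = mx33 0 (-1) 0 1 0 0 0 0 0.
Proof. by mx33_entries; rewrite ?(mulr0, mulr1, subr0, sub0r, oppr0). Qed.

Lemma hat_e2 : hat (e2 R) = mx33 0 0 1 0 0 0 (-1) 0 0.
Proof. by mx33_entries; rewrite ?(mulr0, mulr1, subr0, sub0r, oppr0). Qed.

Lemma expmx_hat_e3 t :
  expmx (t *: hat (e3 R)) = mx33 (cos t) (- sin t) 0 (sin t) (cos t) 0 0 0 1.
Proof.
rewrite expmx_rodrigues hat_e3 ?mul_mx33.
- by mx33_entries; ring.
- by mx33_entries; ring.
- by mx33_entries; ring.
Qed.

Lemma expmx_hat_e2 t :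
  expmx (t *: hat (e2 R)) = mx33 (cos t) 0 (sin t) 0 1 0 (- sin t) 0 (cos t).
Proof.
rewrite expmx_rodrigues hat_e2 ?mul_mx33.
- by mx33_entries; ring.
- by mx33_entries; ring.
- by mx33_entries; ring.
Qed.

Lemma eulerE a b c :
  euler a b c = mx33
    (cos a * cos b * cos c - sin a * sin c)
    (- (cos a * cos b * sin c) - sin a * cos c)
    (cos a * sin b)
    (sin a * cos b * cos c + cos a * sin c)
    (- (sin a * cos b * sin c) + cos a * cos c)
    (sin a * sin b)
    (- (sin b * cos c)) (sin b * sin c) (cos b).
Proof.
rewrite /euler !expmx_hat_e3 expmx_hat_e2 !mul_mx33.
move: (cos a) (sin a) (cos b) (sin b) (cos c) (sin c) => ca sa cb sb cc sc.
by congr mx33; ring.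
Qed.

Lemma expiD (x y : R) : expi (x + y) = expi x * expi y.
Proof. by rewrite /expi cosD sinD; simpc; rewrite [X in _ +i* X]addrC. Qed.

Lemma expi_mulr_nat (n : nat) (x : R) : expi (n%:R * x) = expi x ^+ n.
Proof.
elim: n => [|n IH]; first by rewrite mul0r /expi cos0 sin0 expr0.
by rewrite -natr1 mulrDl mul1r expiD IH exprSr.
Qed.

Lemma expi_eqN (x y : R) : expi x = expi y -> expi (- x) = expi (- y).
Proof. by rewrite /expi !cosN !sinN => -[-> ->]. Qed.

Lemma expi_eq_mulr_int (m : int) (x y : R) :
  expi x = expi y -> expi (m%:~R * x) = expi (m%:~R * y).
Proof.
move=> xy; case: m => n; first by rewrite !expi_mulr_nat xy.
by rewrite NegzE mulrNz !mulNr; apply: expi_eqN; rewrite !expi_mulr_nat xy.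
Qed.

(** With d = y - x, the hypothesis gives cos d = 1, that is sin (d / 2) = 0, while
    a nonzero d would put d / 2 strictly between 0 and pi. *)
Lemma expi_inj_le (x y : R) : 0 <= x -> y < 2 * pi -> x <= y ->
  expi x = expi y -> x = y.
Proof.
move=> x0 y2 xy [cxy sxy]; apply: contrapT => /eqP neq.
have yx : 0 < y - x by rewrite subr_gt0 lt_neqAle neq.
have h0 : 0 < sin ((y - x) / 2) by apply: sin_gt0_pi; lra.
have c1 : cos (y - x) = 1 by rewrite cosB cxy sxy -!expr2 cos2Dsin2.
have dblE : (y - x) / 2 *+ 2 = y - x by rewrite mulr2n; lra.
have := cos_mulr2n ((y - x) / 2); rewrite dblE c1 {dblE c1}.
have := cos2Dsin2 ((y - x) / 2).
have {h0} : 0 < sin ((y - x) / 2) ^+ 2 by rewrite exprn_gt0.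
move: (cos _ ^+ 2) (sin _ ^+ 2) => u v.
by rewrite mulr2n; lra.
Qed.

Lemma expi_inj (x y : R) : 0 <= x < 2 * pi -> 0 <= y < 2 * pi ->
  expi x = expi y -> x = y.
Proof.
move=> /andP[x0 x2] /andP[y0 y2] xy; have [xley|/ltW ylex] := leP x y.
  exact: expi_inj_le xy.
by apply/esym; apply: expi_inj_le (esym xy).
Qed.

(** The last row and column of the rotation give b, and also a and c when
    sin b <> 0.  In the two gimbal-lock cases only a + c (for b = 0) or a - c
    (for b = pi) can be read off, from the first column. *)
Lemma euler_eq (a b c a' b' c' : R) :
  euler_range a b c -> euler_range a' b' c' ->
  euler a b c = euler a' b' c' ->
  b = b' /\
  [\/ a = a' /\ c = c',
      b = 0 /\ expi (a + c) = expi (a' + c') |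
      b = pi /\ expi (a - c) = expi (a' - c')].
Proof.
move=> [ar br cr] [a'r b'r c'r]; rewrite !eulerE => /matrixP E.
have E00 := E 0 0; have E10 := E 1 0; have E02 := E 0 2; have E12 := E 1 2.
have E20 := E 2 0; have E21 := E 2 1; have E22 := E 2 2.
rewrite !mxE /= in E00 E10 E02 E12 E20 E21 E22 => {E}.
have bb' : b = b' by apply: cos_inj E22; rewrite in_itv.
split => //; subst b'.
have [b0|b0] := eqVneq b 0.
  apply: Or32; split => //; move: E00 E10.
  rewrite b0 cos0 !mulr1 => E00 E10.
  by rewrite /expi !cosD !sinD E00 [X in _ +i* X]E10.
have [bpi|bpi] := eqVneq b pi.
  apply: Or33; split => //; move: E00 E10.
  rewrite bpi cospi !mulrN1 !mulNr => E00 E10.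
  rewrite /expi !cosB !sinB; congr (_ +i* _); lra.
apply: Or31.
have sb : sin b != 0.
  apply: lt0r_neq0; apply: sin_gt0_pi; move: br b0 bpi.
  by rewrite !lt_neqAle => /andP[-> ->] + ->; rewrite eq_sym => ->.
split; apply: expi_inj => //; congr (_ +i* _); apply: (mulIf sb) => //.
- by move: E20 => /oppr_inj; rewrite ![sin b * _]mulrC.
- by rewrite ![_ * sin b]mulrC.
Qed.

End EulerAngles.

(** * Matrices indexed by the integers from -l to l *)

Section IntegerIndices.
Variables (K : Type) (l : nat).

Definition zval (i : 'I_(2 * l).+1) : int := i%:Z - l%:Z.

Definition in_range (m : int) : bool := - l%:Z <= m <= l%:Z.

Lemma zval_range i : in_range (zval i).
Proof. by have := ltn_ord i; rewrite /in_range /zval; lia. Qed.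

Lemma in_rangeN m : in_range (- m) = in_range m.
Proof. by rewrite /in_range; lia. Qed.

Lemma in_range0 : in_range 0.
Proof. by rewrite /in_range; lia. Qed.

Lemma zvalK i : inord (absz (zval i + l%:Z)) = i.
Proof. by rewrite /zval subrK absz_nat inord_val. Qed.

Lemma inord_zval m : in_range m -> zval (inord (absz (m + l%:Z))) = m.
Proof. by rewrite /in_range /zval => hm; rewrite inordK; lia. Qed.

Lemma zval_inj : injective zval.
Proof. by move=> i j /addIr [/val_inj]. Qed.

Lemma zentry_zval (M : 'M[K]_((2 * l).+1)) i j :
  zentry M (zval i) (zval j) = M i j.
Proof. by rewrite /zentry !zvalK. Qed.

Lemma zentryP (M N : 'M[K]_((2 * l).+1)) :
  (forall m n, in_range m -> in_range n -> zentry M m n = zentry N m n) ->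
  M = N.
Proof.
by move=> MN; apply/matrixP => i j; rewrite -!zentry_zval MN// zval_range.
Qed.

End IntegerIndices.

Section IntegerSums.
Variables (K : pzRingType) (l : nat).
Implicit Types F : int -> K.
Local Notation in_range := (in_range l).

Lemma zentryM (M N : 'M[K]_((2 * l).+1)) m n :
  zentry (M *m N) m n = \sum_k zentry M m (@zval l k) * zentry N (zval k) n.
Proof.
by rewrite {1}/zentry mxE; apply: eq_bigr => k _; rewrite /zentry !zvalK.
Qed.

Lemma sum_zval_single F p : (forall k, k != p -> F k = 0) ->
  \sum_k F (@zval l k) = if in_range p then F p else 0.
Proof.
move=> F0; case: ifP => hp.
  rewrite (bigD1 (inord (absz (p + l%:Z))))//= inord_zval//.
  rewrite big1 ?addr0// => k kp.
  by apply: F0; apply: contra kp => /eqP <-; rewrite zvalK.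
apply: big1 => k _; apply: F0; apply: contraFN hp => /eqP <-.
exact: zval_range.
Qed.

(** The sum of F over the integers k with |k| = |m|; for m = 0 there is only one
    such k. *)
Definition sum_pm (m : int) F : K := if m == 0 then F 0 else F m + F (- m).

Lemma sum_zval_pm F m : in_range m -> (forall k, `|k| != `|m| -> F k = 0) ->
  \sum_k F (@zval l k) = sum_pm m F.
Proof.
move=> hm F0; rewrite /sum_pm; case: eqVneq => [m0|m0].
  rewrite (sum_zval_single (p := 0)); last by move=> k k0; apply: F0; lia.
  by rewrite in_range0.
rewrite (bigD1 (inord (absz (m + l%:Z))))//= inord_zval//; congr (_ + _).
rewrite big_mkcond /=.
pose H p := if p == m then 0 else F p.
rewrite (eq_bigr (fun k => H (zval k))) => [|k _]; last first.
  rewrite /H -{1}[k]zvalK.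
  have [->|km] := eqVneq (zval k) m; first by rewrite eqxx.
  rewrite ifT//; apply: contra km => /eqP /(congr1 (@zval l)).
  by rewrite !inord_zval ?zval_range// => ->.
rewrite (sum_zval_single (p := - m)) => [|k kNm]; last first.
  by rewrite /H; case: eqVneq => // km; apply: F0; lia.
by rewrite in_rangeN hm /H; case: eqP => //; lia.
Qed.

(** The matrices of the change to the real basis, and those of the rotations
    about the third axis in that basis, only mix the indices m and - m; a product
    with two of them has at most four terms per entry. *)
Lemma zentry_sandwich (P M Q : 'M[K]_((2 * l).+1)) m n :
  in_range m -> in_range n ->
  (forall k, in_range k -> `|k| != `|m| -> zentry P m k = 0) ->
  (forall k, in_range k -> `|k| != `|n| -> zentry Q k n = 0) ->
  zentry (P *m M *m Q) m n =
  sum_pm n (fun q =>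
    sum_pm m (fun p => zentry P m p * zentry M p q) * zentry Q q n).
Proof.
move=> hm hn P0 Q0; rewrite zentryM.
(* The hypotheses only speak of indices in the range: outside of it the
   summand is replaced by 0. *)
pose G q := if in_range q then zentry (P *m M) m q * zentry Q q n else 0.
rewrite (eq_bigr (fun k => G (zval k))); last first.
  by move=> k _; rewrite /G zval_range.
rewrite (sum_zval_pm hn); last first.
  by move=> k kn; rewrite /G; case: ifP => // hk; rewrite Q0// mulr0.
have GE q : in_range q -> G q =
    sum_pm m (fun p => zentry P m p * zentry M p q) * zentry Q q n.
  move=> hq; rewrite /G hq zentryM; congr (_ * _).
  pose H p := if in_range p then zentry P m p * zentry M p q else 0.
  rewrite (eq_bigr (fun k => H (zval k))); last first.
    by move=> k _; rewrite /H zval_range.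
  rewrite (sum_zval_pm hm); last first.
    by move=> k km; rewrite /H; case: ifP => // hk; rewrite P0// mul0r.
  by rewrite /sum_pm /H in_rangeN hm in_range0.
rewrite /sum_pm; case: eqP => [_|_]; first by rewrite GE ?in_range0.
by rewrite !GE ?in_rangeN.
Qed.

End IntegerSums.

(** * Symmetries of the Wigner d-matrix *)

Section WignerGenerator.
Variables (R : realType) (l : nat).
Local Notation A := (wignerA R l).

(** Half the factor of the ladder operators between the weights m - 1 and m. *)
Definition ladder (m : int) : R :=
  2^-1 * Num.sqrt ((l%:Z + m) * (l%:Z - m + 1))%:~R.

Lemma ladder1B m : ladder (1 - m) = ladder m.
Proof. by rewrite /ladder; congr (_ * Num.sqrt _%:~R); ring. Qed.

Lemma ladderN m : ladder (- m) = ladder (m + 1).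
Proof. by rewrite -ladder1B; congr ladder; ring. Qed.

Lemma ladder_sqr m : - l%:Z <= m <= l%:Z + 1 ->
  ladder m ^+ 2 = 4^-1 * ((l%:Z + m) * (l%:Z - m + 1))%:~R.
Proof.
move=> hm; rewrite /ladder exprMn sqr_sqrtr; last first.
  by rewrite ler0z mulr_ge0//; lia.
by congr (_ * _); lra.
Qed.

(** Half the operators J_- and J_+ of angular momentum, so that the generator
    -i J_y is their difference and J_x their sum. *)
Definition halfJminus : 'M[R]_((2 * l).+1) :=
  zmx l (fun m n => ladder (m + 1) * (m + 1 == n)%:R).
Definition halfJplus : 'M[R]_((2 * l).+1) :=
  zmx l (fun m n => ladder m * (m - 1 == n)%:R).

Lemma wignerAE : A = halfJminus - halfJplus.
Proof.
apply/matrixP => i j; rewrite !mxE [LHS]addrC; congr (_ * _ + - (_ * _)).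
by rewrite /ladder; congr (_ * Num.sqrt _%:~R); ring.
Qed.

Lemma trmx_halfJminus : halfJminus^T = halfJplus.
Proof.
apply/matrixP => i j; rewrite !mxE.
have -> : (j%:Z - l%:Z + 1 == i%:Z - l%:Z) =
    (i%:Z - l%:Z - 1 == j%:Z - l%:Z) by lia.
case: eqP => [ij|_]; last by rewrite !mulr0.
by congr (ladder _ * _); lia.
Qed.

Lemma trmx_wignerA : A^T = - A.
Proof.
by rewrite wignerAE linearB /= -trmx_halfJminus trmxK opprB.
Qed.

(** Angular momentum about the third axis, in a basis of its eigenvectors. *)
Definition Jz : 'M[R]_((2 * l).+1) := diag_mx (\row_i (@zval l i)%:~R).

Local Notation Jx := (halfJminus + halfJplus).

Lemma mulmx_Jz (M : 'M[R]_((2 * l).+1)) i j :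
  (M *m Jz) i j = M i j * (zval j)%:~R.
Proof. by rewrite mul_mx_diag !mxE. Qed.

Lemma mulJz_mx (M : 'M[R]_((2 * l).+1)) i j :
  (Jz *m M) i j = (zval i)%:~R * M i j.
Proof. by rewrite mul_diag_mx !mxE. Qed.

Lemma halfJminus_halfJplus i j : (halfJminus *m halfJplus) i j =
  ladder (zval i + 1) ^+ 2 * (i == j)%:R.
Proof.
rewrite mxE.
pose F k := ladder (zval i + 1) * (zval i + 1 == k)%:R *
            (ladder k * (k - 1 == zval j)%:R).
rewrite (eq_bigr (fun k => F (zval k))) => [|k _]; last by rewrite !mxE.
rewrite (@sum_zval_single _ l F (zval i + 1)) => [|k ki]; last first.
  by rewrite /F eq_sym (negbTE ki) mulr0 mul0r.
rewrite /F eqxx mulr1 mulrA -expr2 addrK (inj_eq (@zval_inj l)).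
(* At the top weight zval i = l there is no index above, but the factor
   vanishes there too. *)
case: ifP => // hi; have -> : zval i + 1 = 1 - (- l%:Z).
  by move: hi (zval_range i); rewrite /in_range; lia.
by rewrite ladder1B /ladder subrr mul0r mulr0z sqrtr0 mulr0 expr0n mul0r.
Qed.

Lemma halfJplus_halfJminus i j : (halfJplus *m halfJminus) i j =
  ladder (zval i) ^+ 2 * (i == j)%:R.
Proof.
rewrite mxE.
pose F k := ladder (zval i) * (zval i - 1 == k)%:R *
            (ladder (k + 1) * (k + 1 == zval j)%:R).
rewrite (eq_bigr (fun k => F (zval k))) => [|k _]; last by rewrite !mxE.
rewrite (@sum_zval_single _ l F (zval i - 1)) => [|k ki]; last first.
  by rewrite /F eq_sym (negbTE ki) mulr0 mul0r.
rewrite /F eqxx mulr1 mulrA subrK -expr2 (inj_eq (@zval_inj l)).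
case: ifP => // hi; have -> : zval i = - l%:Z.
  by move: hi (zval_range i); rewrite /in_range; lia.
by rewrite /ladder subrr mul0r mulr0z sqrtr0 mulr0 expr0n mul0r.
Qed.

Lemma wignerA_comm_Jz : A *m Jz - Jz *m A = Jx.
Proof.
apply/matrixP => i j.
rewrite wignerAE [LHS]mxE [X in _ + X]mxE mulmx_Jz mulJz_mx !mxE.
rewrite -/(zval i) -/(zval j).
case: eqP => [<-|_]; case: eqP => [h|_]; rewrite ?(mulr0, mulr1) //.
- by exfalso; lia.
- by rewrite rmorphD /= rmorph1; ring.
- by rewrite -h rmorphB /= rmorph1; ring.
- by ring.
Qed.

(** Expanding, the commutator is twice that of the two halves of J_- and J_+, whose
    products are diagonal; and (l - m) (l + m + 1) - (l + m) (l - m + 1) = - 2 m. *)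
Lemma wignerA_comm_Jx :
  A *m Jx - Jx *m A = - Jz.
Proof.
have -> : A *m Jx - Jx *m A =
    (halfJminus *m halfJplus - halfJplus *m halfJminus) *+ 2.
  rewrite wignerAE !mulmxDl !mulmxDr !mulmxN !mulNmx.
  move: (halfJminus *m halfJminus) (halfJplus *m halfJplus)
    (halfJminus *m halfJplus)
    (halfJplus *m halfJminus) => a b c d.
  by apply/matrixP => i j; rewrite !mxE; ring.
apply/matrixP => i j.
have := halfJminus_halfJplus i j; have := halfJplus_halfJminus i j.
move: (halfJminus *m halfJplus) (halfJplus *m halfJminus) => P Q QE PE.
rewrite mulr2n !mxE PE QE.
have hi := zval_range i; rewrite /in_range in hi.
rewrite !ladder_sqr; [|lia|lia].
case: eqVneq => [_|_]; last by rewrite !mulr0 mulr0n; ring.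
rewrite !mulr1 mulr1n !(rmorphM, rmorphD, rmorphB, rmorphN, rmorph1) /=.
by field.
Qed.

Lemma wignerd_comm_Jz t : wignerd l t *m Jz =
  (cos t *: Jz + sin t *: Jx) *m wignerd l t.
Proof.
exact: (expmx_rotate trmx_wignerA t wignerA_comm_Jz wignerA_comm_Jx).
Qed.

Lemma wignerd0 : wignerd l 0 = 1%:M :> 'M[R]_((2 * l).+1).
Proof. by rewrite /wignerd scale0r expmx0. Qed.

(** The half turn about the second axis reverses the third one: d(pi) Jz = - Jz d(pi),
    so d(pi) maps the weight n to the weight - n.  Only this vanishing, not the
    values on the antidiagonal, enters the comparison of Euler angles. *)
Lemma wignerd_pi_eq0 i j : zval i != - zval j -> wignerd l pi i j = 0 :> R.
Proof.
move=> ij; have /matrixP /(_ i j) := wignerd_comm_Jz pi.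
rewrite cospi sinpi scale0r addr0 scaleN1r mulNmx mulmx_Jz => E.
have : (zval i + zval j)%:~R * wignerd l pi i j = 0 :> R.
  by rewrite intrD mulrDl [X in _ + X]mulrC E [X in _ + X]mxE mulJz_mx subrr.
by move/eqP; rewrite mulf_eq0 intr_eq0 addr_eq0 (negbTE ij) => /eqP.
Qed.

Lemma signzN (m : int) : (-1) ^ (- m) = (-1) ^ m :> R.
Proof. by rewrite -exprz_inv invrN invr1. Qed.

Lemma signzD (m n : int) : (-1) ^ (m + n) = (-1) ^ m * (-1) ^ n :> R.
Proof. by rewrite expfzDr// oppr_eq0 oner_eq0. Qed.

Lemma signz_sqr (m : int) : (-1) ^ m * (-1) ^ m = 1 :> R.
Proof. by rewrite -{2}signzN -signzD subrr expr0z. Qed.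

Definition reflection : 'M[R]_((2 * l).+1) :=
  zmx l (fun m n => (-1) ^ m * (m == - n)%:R).

Lemma zentry_reflection_mul (M : 'M[R]_((2 * l).+1)) m n :
  in_range l m -> in_range l n ->
  zentry (reflection *m M) m n = (-1) ^ m * zentry M (- m) n.
Proof.
move=> hm hn; rewrite zentryM.
pose F k := (-1) ^ m * (m == - k)%:R * zentry M k n.
rewrite (eq_bigr (fun k => F (zval k))) => [|k _]; last first.
  by rewrite zentry_zmx//; exact: zval_range.
rewrite (@sum_zval_single _ l F (- m)) => [|k km].
  by rewrite in_rangeN hm /F opprK eqxx mulr1.
by rewrite /F -eqr_oppLR eq_sym (negbTE km) mulr0 mul0r.
Qed.

Lemma zentry_mul_reflection (M : 'M[R]_((2 * l).+1)) m n :
  in_range l m -> in_range l n ->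
  zentry (M *m reflection) m n = (-1) ^ n * zentry M m (- n).
Proof.
move=> hm hn; rewrite zentryM.
pose F k := zentry M m k * ((-1) ^ k * (k == - n)%:R).
rewrite (eq_bigr (fun k => F (zval k))) => [|k _]; last first.
  by rewrite zentry_zmx//; exact: zval_range.
rewrite (@sum_zval_single _ l F (- n)) => [|k kn].
  by rewrite in_rangeN hn /F eqxx mulr1 signzN mulrC.
by rewrite /F (negbTE kn) !mulr0.
Qed.

(** Reversing the weights changes the sign of the generator, whose only nonzero
    entries have m - n = 1 or -1; the alternating sign in the reflection absorbs
    that change. *)
Lemma wignerA_reflection : A *m reflection = reflection *m A.
Proof.
apply: zentryP => m n hm hn.
rewrite zentry_mul_reflection// zentry_reflection_mul// wignerAE.
have entryE p q : in_range l p -> in_range l q ->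
    zentry (halfJminus - halfJplus) p q =
    ladder (p + 1) * (p + 1 == q)%:R - ladder p * (p - 1 == q)%:R.
  move=> hp hq; rewrite /zentry !mxE.
  by rewrite -!/(zval _) !inord_zval.
have ladder_N1 : ladder (- m + 1) = ladder m by rewrite addrC ladder1B.
rewrite !entryE ?in_rangeN// ladderN ladder_N1.
have -> : (m + 1 == - n) = (- m - 1 == n) by lia.
have -> : (m - 1 == - n) = (- m + 1 == n) by lia.
case: eqP => [<-|_]; case: eqP => [h|_]; rewrite ?(mulr0, mulr1) //.
- by exfalso; lia.
- by rewrite signzD !signzN expr1z; ring.
- by rewrite -h signzD !signzN expr1z; ring.
- by ring.
Qed.

(** The one symmetry of the d-matrix needed for the real harmonics: it inherits
    the commutation of its generator with the reflection. *)
Lemma wignerd_opp (t : R) m n : in_range l m -> in_range l n ->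
  zentry (wignerd l t) (- m) (- n) =
  (-1) ^ m * (-1) ^ n * zentry (wignerd l t) m n.
Proof.
move=> hm hn.
have := expmx_skew_comm trmx_wignerA t wignerA_reflection.
move/(congr1 (fun M => zentry M m (- n))).
rewrite zentry_mul_reflection ?in_rangeN// zentry_reflection_mul ?in_rangeN//.
rewrite opprK signzN => E.
by rewrite -mulrA E mulrA signz_sqr mul1r.
Qed.

End WignerGenerator.

(** * The Wigner matrix as a function of the Euler angles *)

Section WignerMatrix.
Variables (R : realType) (l : nat).

Lemma expi_mul_opp (m : int) (x y : R) :
  expi (- (m%:~R * x)) * expi (- (m%:~R * y)) = expi (m%:~R * (- (x + y))).
Proof. by rewrite -expiD; congr expi; ring. Qed.

(** When the angles differ, b is 0 or pi.  Then d(b) is supported on the diagonal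
    n = m, resp. the antidiagonal n = - m, where the two phases combine into a
    function of a + c, resp. a - c, and this is determined by the rotation. *)
Lemma wignerD_euler_congr (a b c a' b' c' : R) :
  euler_range a b c -> euler_range a' b' c' ->
  euler a b c = euler a' b' c' ->
  wignerD_euler l a b c = wignerD_euler l a' b' c'.
Proof.
move=> r r' /(euler_eq r r') [<- {b'} {r'}].
move=> [[<- <-]//|[b0 ac]|[bpi ac]]; apply/matrixP => i j;
  rewrite !mxE -/(zval i) -/(zval j) zentry_zval mulrAC [in RHS]mulrAC.
- rewrite b0 wignerd0 mxE; case: eqVneq => [<-|_]; last by rewrite !mulr0.
  congr (_ * _); rewrite !expi_mul_opp; apply: expi_eq_mulr_int.
  exact: expi_eqN.
- have [ij|ij] := eqVneq (zval i) (- zval j); last first.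
    by rewrite bpi wignerd_pi_eq0// !mulr0.
  congr (_ * _); have -> : zval j = - zval i by rewrite ij opprK.
  have opp_angle (x : R) : - ((- zval i)%:~R * x) = - ((zval i)%:~R * - x).
    by rewrite mulrNz mulNr mulrN.
  by rewrite !opp_angle !expi_mul_opp; exact/expi_eq_mulr_int/expi_eqN.
Qed.

Lemma wignerD_eulerE (a b c : R) :
  euler_range a b c -> wignerD l (euler a b c) = wignerD_euler l a b c.
Proof.
move=> r; rewrite /wignerD; set P := (X in xget _ X).
have [] : P (xget (0, 0, 0) P) by apply: xgetPex; exists (a, b, c).
case: (xget _ _) => [[a' b'] c'] /= r' /esym E.
exact/esym/wignerD_euler_congr.
Qed.

End WignerMatrix.

(** * Entries of the real harmonics *)

(** Case analysis on the sign that names the absolute value p, so that both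
    negative and positive indices are expressed with the same p > 0. *)
Variant sign_spec : int -> Type :=
  | SignZero : sign_spec 0
  | SignPos (p : int) of 0 < p : sign_spec p
  | SignNeg (p : int) of 0 < p : sign_spec (- p).

Lemma signP m : sign_spec m.
Proof.
case: (ltrgt0P m) => [m0|m0|->]; first exact: SignPos.
  by rewrite -[m]opprK; apply: SignNeg; rewrite oppr_gt0.
exact: SignZero.
Qed.

(** A rewriting multirule evaluating the tests on the signs of p and - p in
    the definitions by cases. *)
Lemma pos_signs (p : int) : 0 < p ->
  ((p == 0) = false) * ((- p == 0) = false) * ((0 < p) = true) *
  ((0 < - p) = false) * ((p == - p) = false) * ((- p == p) = false) *
  ((p < 0) = false) * ((- p < 0) = true) * ((0 <= p) = true) *
  ((0 <= - p) = false) * (`|p| = p) * (`|- p| = p) * (Num.sg p = 1) *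
  (Num.sg (- p) = -1) * (- - p = p).
Proof.
by move=> p0; do ![split]; lia.
Qed.

Section RealHarmonics.
Variables (R : realType) (l : nat).
Local Notation in_range := (in_range l).
Local Notation T := (Tmx R l).
(* This is 1 / sqrt 2; in this form, the factor sqrt 2 of Psi is 2 r. *)
Local Notation r := (Num.sqrt (2 : R) / 2).

Lemma sqrt2V : (Num.sqrt (2 : R))^-1 = r.
Proof.
apply: (mulfI (x := Num.sqrt (2 : R))); first by rewrite sqrtr_eq0; lra.
rewrite mulfV ?mulrA ?sqrtr_eq0; last by lra.
by rewrite -expr2 sqr_sqrtr; lra.
Qed.

Lemma signz_complex (m : int) : (-1) ^ m = ((-1) ^ m)%:C :> R[i].
Proof. by rewrite fmorphXz rmorphN1. Qed.

Lemma Tmx_entries p : 0 < p -> in_range p ->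
  (zentry T p p = ((-1) ^ p * r)%:C) * (zentry T p (- p) = r%:C) *
  (zentry T (- p) (- p) = 0 +i* r) *
  (zentry T (- p) p = 0 +i* (- ((-1) ^ p * r))).
Proof.
move=> p0 hp; have hNp : in_range (- p) by rewrite in_rangeN.
rewrite !zentry_zmx// !(pos_signs p0) /= !eqxx /= !signz_complex signzN.
rewrite -fmorphV sqrt2V.
do !split.
- by rewrite -rmorphM.
- by rewrite mul1r.
- by simpc.
- by simpc.
Qed.

Lemma Tmx00 : zentry T 0 0 = 1.
Proof. by rewrite zentry_zmx //=; exact: in_range0. Qed.

Lemma Tmx_eq0 m k : in_range m -> in_range k -> `|k| != `|m| ->
  zentry T m k = 0.
Proof.
move=> hm hk km; rewrite zentry_zmx//=.
case: ifP => [/andP[/eqP m0 /eqP k0]|_]; first by rewrite m0 k0 eqxx in km.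
by rewrite [`|m| == _]eq_sym km.
Qed.

Lemma Psi_pm (b : R) p q : 0 < p -> 0 < q ->
  let d := zentry (wignerd l b) in
  let P := (-1) ^ p * (-1) ^ q * d p q + (-1) ^ p * d p (- q) in
  let N := (-1) ^ p * (-1) ^ q * d p q - (-1) ^ p * d p (- q) in
  (Psi l b p q = P) * (Psi l b p (- q) = P) *
  (Psi l b (- p) q = N) * (Psi l b (- p) (- q) = N).
Proof.
move=> p0 q0 d P N; rewrite /Psi !mulf_eq0 !(pos_signs p0) !(pos_signs q0) /=.
by rewrite !signzD !signzN mulr1 /P /N !mulrN1 mulNr.
Qed.

Lemma sqrt2E : 2 * r = Num.sqrt (2 : R).
Proof. by lra. Qed.

Lemma Psi_row0 (b : R) q : 0 < q ->
  let P := (-1) ^ q * (2 * r) * zentry (wignerd l b) 0 q in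
  (Psi l b 0 q = P) * (Psi l b 0 (- q) = P).
Proof.
move=> q0 P; rewrite /Psi !mul0r eqxx !(pos_signs q0) /= normr0.
by rewrite !signzD !signzN expr0z mul1r /P sqrt2E.
Qed.

Lemma Psi_col0 (b : R) p : 0 < p ->
  let P := (-1) ^ p * (2 * r) * zentry (wignerd l b) p 0 in
  (Psi l b p 0 = P) * (Psi l b (- p) 0 = P).
Proof.
move=> p0 P; rewrite /Psi !mulr0 eqxx !(pos_signs p0) /= normr0.
by rewrite !signzD !signzN expr0z mulr1 /P sqrt2E.
Qed.

Lemma Psi_oppr (b : R) m n : Psi l b m n = Psi l b m (- n).
Proof.
by rewrite /Psi !mulf_eq0 !oppr_eq0 normrN !signzD !signzN.
Qed.

Lemma wignerd_oppl (b : R) p q : in_range p -> in_range q ->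
  zentry (wignerd l b) (- p) q =
  (-1) ^ p * (-1) ^ q * zentry (wignerd l b) p (- q).
Proof.
by move=> hp hq; rewrite -[in LHS](opprK q) wignerd_opp ?in_rangeN// signzN.
Qed.

Lemma wignerd_opp_row0 (b : R) q : in_range q ->
  zentry (wignerd l b) 0 (- q) = (-1) ^ q * zentry (wignerd l b) 0 q.
Proof.
by move=> hq; rewrite -{1}oppr0 wignerd_opp ?in_range0// expr0z mul1r.
Qed.

Lemma wignerd_opp_col0 (b : R) p : in_range p ->
  zentry (wignerd l b) (- p) 0 = (-1) ^ p * zentry (wignerd l b) p 0.
Proof.
by move=> hp; rewrite -{1}oppr0 wignerd_opp ?in_range0// expr0z mulr1.
Qed.

Ltac complex_parts :=
  apply/eqP; rewrite eq_complex /=; apply/andP; split; apply/eqP.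

Definition harmonic_entry (a b c : R) (m n : int) : R :=
  if same_sign m n then
    - (sin (m%:~R * a) * sin (n%:~R * c) * Psi l b (- m) n)
    + cos (m%:~R * a) * cos (n%:~R * c) * Psi l b m n
  else
    - (sin (m%:~R * a) * cos (n%:~R * c) * Psi l b (- m) n)
    + cos (m%:~R * a) * sin (n%:~R * c) * Psi l b m n.

Lemma expi_opp (p : int) (x : R) :
  (expi (- (p%:~R * x)) = cos (p%:~R * x) +i* - sin (p%:~R * x)) *
  (expi (- ((- p)%:~R * x)) = cos (p%:~R * x) +i* sin (p%:~R * x)).
Proof. by rewrite /expi mulrNz mulNr opprK cosN sinN. Qed.

Lemma cos_sin_opp (p : int) (x : R) :
  (cos ((- p)%:~R * x) = cos (p%:~R * x)) *
  (sin ((- p)%:~R * x) = - sin (p%:~R * x)).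
Proof. by rewrite mulrNz mulNr cosN sinN. Qed.

(** A pair of nonzero indices gives four terms: d m n and d (-m) (-n), which agree
    up to sign, carry the conjugate phases of m a + n c, and d m (-n) and
    d (-m) n those of m a - n c.  Conjugate phases add up to a cosine or, thanks
    to the factors i in the rows of negative index, to a sine; the addition
    formulas then regroup the result into the two combinations Psi. *)
Lemma zentry_realU (a b c : R) m n : euler_range a b c ->
  in_range m -> in_range n ->
  zentry (realU l (euler a b c)) m n = (harmonic_entry a b c m n)%:C.
Proof.
move=> abc hm hn; rewrite /realU wignerD_eulerE//.
have conjT p q : zentry (map_mx conjc T) p q = conjc (zentry T p q).
  by rewrite /zentry mxE.
have trT p q : zentry T^T p q = zentry T q p by rewrite /zentry mxE.
rewrite zentry_sandwich//; last 2 first.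
- by move=> k hk km; rewrite conjT Tmx_eq0 ?rmorph0.
- by move=> k hk km; rewrite trT Tmx_eq0.
have DE p q : in_range p -> in_range q -> zentry (wignerD_euler l a b c) p q =
    expi (- (p%:~R * a)) * (zentry (wignerd l b) p q)%:C * expi (- (q%:~R * c)).
  by move=> hp hq; rewrite zentry_zmx.
have expi0 (x : R) : expi (- (0%:~R * x)) = 1.
  by rewrite mul0r oppr0 /expi cos0 sin0.
have rr : 2 * (r * r) = 1.
  have : Num.sqrt (2 : R) ^+ 2 = 2 by rewrite sqr_sqrtr; lra.
  by rewrite expr2; lra.
have trig0 (x : R) : (cos (0%:~R * x) = 1) * (sin (0%:~R * x) = 0).
  by rewrite mul0r cos0 sin0.
have sgn_case (p : int) : (-1) ^ p = 1 :> R \/ (-1) ^ p = -1 :> R.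
  have := signz_sqr R p; rewrite -expr2 => /eqP.
  by rewrite sqrf_eq1 => /orP[] /eqP; [left|right].
rewrite /sum_pm /harmonic_entry /same_sign; move: hm hn.
case: (signP m) => [|p p0|p p0]; case: (signP n) => [|q q0|q q0];
  rewrite ?in_rangeN => hm hn;
  rewrite ?eqxx ?(pos_signs p0) ?(pos_signs q0) /= !conjT !trT.
(* Both indices are nonzero. *)
5, 6, 8, 9:
  rewrite !(Tmx_entries p0 hm) !(Tmx_entries q0 hn) !DE ?in_rangeN// !expi_opp;
  rewrite ?cos_sin_opp !(Psi_pm b p0 q0) wignerd_opp// (wignerd_oppl _ hm hn);
  move: (cos (p%:~R * a)) (sin (p%:~R * a)) => ca sa;
  move: (cos (q%:~R * c)) (sin (q%:~R * c)) => cc sc;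
  move: (zentry _ p q) (zentry _ p (- q)) rr (sgn_case p) (sgn_case q) => x y;
  move: r ((-1) ^ p) ((-1) ^ q) => h e d hh ee dd;
  by complex_parts; rewrite -[RHS]mul1r -hh;
    case: ee => ->; case: dd => ->; ring.
(* Only m is zero. *)
2, 3:
  rewrite !Tmx00 !(Tmx_entries q0 hn) !DE ?in_rangeN ?in_range0// !expi0;
  rewrite !expi_opp ?cos_sin_opp !trig0 oppr0 !(Psi_row0 b q0);
  rewrite wignerd_opp_row0//;
  move: (cos (q%:~R * c)) (sin (q%:~R * c)) => cc sc;
  move: (zentry _ 0 q) (sgn_case q) => x;
  move: r ((-1) ^ q) => h d dd;
  by complex_parts; case: dd => ->; ring.
(* Only n is zero. *)
2, 3:
  rewrite !Tmx00 !(Tmx_entries p0 hm) !DE ?in_rangeN ?in_range0// !expi0;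
  rewrite !expi_opp ?cos_sin_opp !trig0 !(Psi_col0 b p0) wignerd_opp_col0//;
  move: (cos (p%:~R * a)) (sin (p%:~R * a)) => ca sa;
  move: (zentry _ p 0) (sgn_case p) => x;
  move: r ((-1) ^ p) => h e ee;
  by complex_parts; case: ee => ->; ring.
rewrite !Tmx00 DE// !expi0 !trig0 /Psi mulr0 eqxx /=.
by move: (zentry _ 0 0) => x; complex_parts; ring.
Qed.

Lemma Xmx_entries (a : R) p : 0 < p -> in_range p ->
  (zentry (Xmx l a) p p = cos (p%:~R * a)) *
  (zentry (Xmx l a) p (- p) = - sin (p%:~R * a)) *
  (zentry (Xmx l a) (- p) (- p) = cos (p%:~R * a)) *
  (zentry (Xmx l a) (- p) p = sin (p%:~R * a)).
Proof.
move=> p0 hp; have hNp : in_range (- p) by rewrite in_rangeN.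
rewrite !zentry_zmx// !(pos_signs p0) !eqxx /= cos_sin_opp.
by do !split; rewrite mulrNz mulNr sinN opprK.
Qed.

Lemma Xmx00 (a : R) : zentry (Xmx l a) 0 0 = 1.
Proof. by rewrite zentry_zmx //=; exact: in_range0. Qed.

Lemma Xmx_eq0 (a : R) m k : in_range m -> in_range k -> `|m| != `|k| ->
  zentry (Xmx l a) m k = 0.
Proof. by move=> hm hk mk; rewrite zentry_zmx// mk. Qed.

(** The matrix W couples only indices of the same sign, so at most two of the
    four terms survive, and they are those of the closed form. *)
Lemma zentry_XWX (a b c : R) m n : in_range m -> in_range n ->
  zentry (Xmx l a *m Wmx l b *m Xmx l c) m n = harmonic_entry a b c m n.
Proof.
move=> hm hn; rewrite zentry_sandwich//; last 2 first.
- by move=> k hk km; rewrite Xmx_eq0// eq_sym.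
- by move=> k hk km; rewrite Xmx_eq0.
have WE p q : in_range p -> in_range q ->
    zentry (Wmx l b) p q = if same_sign p q then Psi l b p q else 0.
  by move=> hp hq; rewrite zentry_zmx.
have trig0 (x : R) : (cos (0%:~R * x) = 1) * (sin (0%:~R * x) = 0).
  by rewrite mul0r cos0 sin0.
rewrite /sum_pm /harmonic_entry; move: hm hn.
case: (signP m) => [|p p0|p p0]; case: (signP n) => [|q q0|q q0];
  rewrite ?in_rangeN => hm hn;
  rewrite ?eqxx ?(pos_signs p0) ?(pos_signs q0) ?oppr0;
  rewrite !WE ?in_rangeN ?in_range0//;
  rewrite /same_sign ?lexx ?ltxx ?(pos_signs p0) ?(pos_signs q0) /=;
  rewrite ?Xmx00 ?(Xmx_entries _ p0 hm) ?(Xmx_entries _ q0 hn);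
  rewrite ?cos_sin_opp ?trig0;
  rewrite ?(Psi_row0 b q0) ?(Psi_col0 b p0) ?(Psi_pm b p0 q0); ring.
Qed.

End RealHarmonics.

Theorem theorem1 (R : realType) (l : nat) :
  (forall (b : R) (m n : int), - l%:Z <= m <= l%:Z -> - l%:Z <= n <= l%:Z ->
     Psi l b m n = Psi l b m (- n))
  /\
  (forall a b c : R,
     0 <= a < 2 * pi -> 0 <= b <= pi -> 0 <= c < 2 * pi ->
     (forall m n : int, - l%:Z <= m <= l%:Z -> - l%:Z <= n <= l%:Z ->
        ((0 <= m /\ 0 <= n) \/ (m < 0 /\ n < 0) ->
           zentry (realU l (euler a b c)) m n =
           (- (sin (m%:~R * a) * sin (n%:~R * c) * Psi l b (- m) n)
            + cos (m%:~R * a) * cos (n%:~R * c) * Psi l b m n)%:C)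
        /\
        ((0 <= m /\ n < 0) \/ (m < 0 /\ 0 <= n) ->
           zentry (realU l (euler a b c)) m n =
           (- (sin (m%:~R * a) * cos (n%:~R * c) * Psi l b (- m) n)
            + cos (m%:~R * a) * sin (n%:~R * c) * Psi l b m n)%:C))
     /\
     realU l (euler a b c) =
       map_mx (real_complex R) (Xmx l a *m Wmx l b *m Xmx l c)).
Proof.
split=> [b m n _ _|a b c ha hb hc]; first exact: Psi_oppr.
have abc : euler_range a b c by split.
split=> [m n hm hn|].
  rewrite zentry_realU// /harmonic_entry.
  split=> hs.
    by have -> : same_sign m n by rewrite /same_sign; lia.
  by have -> : same_sign m n = false by rewrite /same_sign; lia.
apply: zentryP => m n hm hn.
by rewrite zentry_realU// -zentry_XWX// /zentry [RHS]mxE.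
Qed.
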